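(* Let $a,b$ be positive integers. Let $U_{n,\ell}^{(a,b)}$ be the total number of $\mathbf{u}$-steps at level $\ell+1$ over all colored $(a,b)$-Dyck paths of length $2n+2$. Then for all integers $n\ge\ell\ge 0$, $$U_{n,\ell}^{(a,b)}=\sum_{j=0}^{n-\ell}\binom{n-\ell}{j}\left\{\frac{2(\ell+1)(a-b)}{2n-j+2}\binom{2n-j+2}{n-\ell}+\frac{(2\ell+3)b}{2n-j+3}\binom{2n-j+3}{n-\ell}\right\}(a-b)^{j}b^{n-j},$$ with $U_{0,0}^{(a,b)}=a$. Moreover, $U_{n,\ell}^{(a,b)}$ is the $(n,\ell)$-entry of the Riordan array $\left(C(a,b;x)^2(a-b+bC(a,b;x)),\ bxC(a,b;x)^2\right)$, i.e. $U_{n,\ell}^{(a,b)}=[x^n]C(a,b;x)^2(a-b+bC(a,b;x))\left(bxC(a,b;x)^2\right)^{\ell}$.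
   Context: A Dyck path of length $2n$ is a lattice path from $(0,0)$ to $(2n,0)$ weakly above the $x$-axis with steps $\mathbf{u}=(1,1)$, $\mathbf{d}=(1,-1)$. A colored $(a,b)$-Dyck path is a Dyck path in which each $\mathbf{d}$-step that is part of a peak (i.e. immediately preceded by a $\mathbf{u}$-step) is colored with one of $a$ colors and every other $\mathbf{d}$-step is colored with one of $b$ colors. A step is at level $\ell$ if the ordinate of its endpoint is $\ell$. $C(a,b;x)=\frac{1-(a-b)x-\sqrt{(1-(a-b)x)^2-4bx}}{2bx}$ is the unique power series with $C=1+(a-b)xC+bxC^2$. A Riordan array $(d(x),h(x))$ has $(n,k)$-entry $[x^n]d(x)h(x)^k$. *)

(* Defs.v *)
From HB Require Import structures.
From mathcomp Require Import all_boot all_order all_algebra.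
From mathcomp Require Import boolp.
From mathcomp Require Import ring.

Set Implicit Arguments.
Unset Strict Implicit.
Unset Printing Implicit Defensive.

Import Order.TTheory GRing.Theory Num.Theory.
Local Open Scope ring_scope.

Record fps (R : Type) := Fps { coefs : nat -> R }.

Lemma fpsP (R : Type) (f g : fps R) : coefs f =1 coefs g -> f = g.
Proof. by case: f g => [f] [g] /= /funext ->. Qed.

HB.instance Definition _ (R : Type) := gen_eqMixin (fps R).
HB.instance Definition _ (R : Type) := gen_choiceMixin (fps R).

Definition fps_zero (R : comNzRingType) : fps R := Fps (fun=> 0).
Definition fps_opp (R : comNzRingType) (f : fps R) : fps R :=
  Fps (fun n => - coefs f n).
Definition fps_add (R : comNzRingType) (f g : fps R) : fps R :=
  Fps (fun n => coefs f n + coefs g n).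
Definition fps_one (R : comNzRingType) : fps R := Fps (fun n => (n == 0%N)%:R).
Definition fps_mul (R : comNzRingType) (f g : fps R) : fps R :=
  Fps (fun n => \sum_(i < n.+1) coefs f i * coefs g (n - i)%N).
Definition fpsX (R : comNzRingType) : fps R := Fps (fun n => (n == 1%N)%:R).

Lemma fps_addA (R : comNzRingType) : associative (@fps_add R).
Proof. by move=> f g h; apply: fpsP => n /=; rewrite addrA. Qed.
Lemma fps_addC (R : comNzRingType) : commutative (@fps_add R).
Proof. by move=> f g; apply: fpsP => n /=; rewrite addrC. Qed.
Lemma fps_add0 (R : comNzRingType) : left_id (fps_zero R) (@fps_add R).
Proof. by move=> f; apply: fpsP => n /=; rewrite add0r. Qed.
Lemma fps_addN (R : comNzRingType) :
  left_inverse (fps_zero R) (@fps_opp R) (@fps_add R).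
Proof. by move=> f; apply: fpsP => n /=; rewrite addNr. Qed.

HB.instance Definition _ (R : comNzRingType) :=
  GRing.isZmodule.Build (fps R)
    (@fps_addA R) (@fps_addC R) (@fps_add0 R) (@fps_addN R).

Definition fps_trunc (R : comNzRingType) (N : nat) (f : fps R) : {poly R} :=
  \poly_(i < N) coefs f i.

Lemma fps_mul_trunc (R : comNzRingType) (N n : nat) (f g : fps R) :
  (n < N)%N ->
  coefs (fps_mul f g) n = (fps_trunc N f * fps_trunc N g)`_n.
Proof.
move=> nN; rewrite coefM /=; apply: eq_bigr => i _; rewrite !coef_poly.
rewrite (leq_trans (ltn_ord i) nN).
by rewrite (leq_ltn_trans (leq_subr i n) nN).
Qed.

Lemma fps_mulC (R : comNzRingType) : commutative (@fps_mul R).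
Proof.
by move=> f g; apply: fpsP => n; rewrite !(@fps_mul_trunc R n.+1) // mulrC.
Qed.

Lemma fps_mulA (R : comNzRingType) : associative (@fps_mul R).
Proof.
have aux f g h n : coefs (fps_mul f (fps_mul g h)) n =
    (fps_trunc n.+1 f * (fps_trunc n.+1 g * fps_trunc n.+1 h))`_n.
  rewrite coefM [LHS]/=; apply: eq_bigr => i _.
  rewrite coef_poly ltn_ord -fps_mul_trunc //.
  by rewrite ltnS leq_subr.
move=> f g h; apply: fpsP => n.
rewrite aux [fps_mul (fps_mul f g) h]fps_mulC aux.
by rewrite mulrA [in RHS]mulrC.
Qed.

Lemma fps_mul1 (R : comNzRingType) : left_id (fps_one R) (@fps_mul R).
Proof.
move=> f; apply: fpsP => n /=.
rewrite big_ord_recl /= mul1r subn0 big1 ?addr0 // => i _.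
by rewrite mul0r.
Qed.

Lemma fps_mulDl (R : comNzRingType) : left_distributive (@fps_mul R) +%R.
Proof.
move=> f g h; apply: fpsP => n /=.
by rewrite -big_split /=; apply: eq_bigr => i _; rewrite mulrDl.
Qed.

Lemma fps_one_neq0 (R : comNzRingType) : fps_one R != 0.
Proof.
apply/eqP => /(congr1 (fun f => coefs f 0%N)) /= /eqP.
by rewrite oner_eq0.
Qed.

HB.instance Definition _ (R : comNzRingType) :=
  GRing.Zmodule_isComNzRing.Build (fps R) (@fps_mulA R) (@fps_mulC R)
    (@fps_mul1 R) (@fps_mulDl R) (@fps_one_neq0 R).

Lemma coefsD (R : comNzRingType) (f g : fps R) n :
  coefs (f + g) n = coefs f n + coefs g n.
Proof. by []. Qed.
Lemma coefsN (R : comNzRingType) (f : fps R) n : coefs (- f) n = - coefs f n.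
Proof. by []. Qed.
Lemma coefs0 (R : comNzRingType) n : coefs (0 : fps R) n = 0.
Proof. by []. Qed.
Lemma coefs1 (R : comNzRingType) n : coefs (1 : fps R) n = (n == 0%N)%:R.
Proof. by []. Qed.
Lemma coefsM (R : comNzRingType) (f g : fps R) n :
  coefs (f * g) n = \sum_(i < n.+1) coefs f i * coefs g (n - i)%N.
Proof. by []. Qed.
Lemma coefsM0 (R : comNzRingType) (f g : fps R) :
  coefs (f * g) 0 = coefs f 0 * coefs g 0.
Proof. by rewrite coefsM big_ord1. Qed.
Lemma coefsMn (R : comNzRingType) (f : fps R) k n :
  coefs (f *+ k) n = coefs f n *+ k.
Proof. by elim: k => [|k IH]; rewrite ?mulr0n // !mulrS coefsD IH. Qed.
Lemma coefs_natM (R : comNzRingType) k (f : fps R) n :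
  coefs (k%:R * f) n = k%:R * coefs f n.
Proof. by rewrite !mulr_natl coefsMn. Qed.
Lemma coefsXM (R : comNzRingType) (f : fps R) n :
  coefs (fpsX R * f) n = if n is m.+1 then coefs f m else 0.
Proof.
rewrite coefsM big_ord_recl /= mul0r add0r.
case: n => [|n]; first by rewrite big_ord0.
rewrite big_ord_recl /= mul1r subSS subn0 big1 ?addr0 // => i _.
by rewrite mul0r.
Qed.

Lemma fpsX_inj (R : comNzRingType) (f g : fps R) :
  fpsX R * f = fpsX R * g -> f = g.
Proof.
move=> E; apply: fpsP => n.
by have := congr1 (fun h => coefs h n.+1) E; rewrite !coefsXM.
Qed.

Lemma fps_regular (R : fieldType) (f g : fps R) :
  coefs g 0 != 0 -> f * g = 0 -> f = 0.
Proof.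
move=> g0 fg; apply: fpsP => n; rewrite coefs0.
elim/ltn_ind: n => n IH.
have := congr1 (fun h => coefs h n) fg; rewrite coefsM coefs0 big_ord_recr /=.
rewrite big1 => [|i _]; last by rewrite IH ?mul0r.
rewrite add0r subnn => /eqP; rewrite mulf_eq0 (negPf g0) orbF.
by move/eqP.
Qed.

(* The square root meant is the one with constant coefficient 1. Comparing coefficients in [r ^+ 2 = f], [r_0 = 1], gives
  [r_(n+1) = (f_(n+1) - \sum_(1 <= i <= n) r_i r_(n+1-i)) / 2];
  [fps_sqrt_seq f n] lists [r_0, r_1, ..., r_n]. *)

Fixpoint fps_sqrt_seq (R : fieldType) (f : fps R) (n : nat) : seq R :=
  if n is m.+1 then
    let s := fps_sqrt_seq f m in
    rcons s ((coefs f n - \sum_(i < m) s`_i.+1 * s`_(m - i)) / 2%:R)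
  else [:: 1].

Definition fps_sqrt (R : fieldType) (f : fps R) : fps R :=
  Fps (fun n => (fps_sqrt_seq f n)`_n).

Lemma size_fps_sqrt_seq (R : fieldType) (f : fps R) n :
  size (fps_sqrt_seq f n) = n.+1.
Proof. by elim: n => //= n IH; rewrite size_rcons IH. Qed.

Lemma nth_fps_sqrt_seq (R : fieldType) (f : fps R) n i :
  (i <= n)%N -> (fps_sqrt_seq f n)`_i = coefs (fps_sqrt f) i.
Proof.
elim: n => [|n IH]; first by rewrite leqn0 => /eqP ->.
rewrite leq_eqVlt => /orP[/eqP -> //|lt_in].
by rewrite /= nth_rcons size_fps_sqrt_seq lt_in IH.
Qed.

Lemma fps_sqrt0 (R : fieldType) (f : fps R) : coefs (fps_sqrt f) 0 = 1.
Proof. by []. Qed.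

Lemma fps_sqrtS (R : fieldType) (f : fps R) n :
  coefs (fps_sqrt f) n.+1 =
  (coefs f n.+1
   - \sum_(i < n) coefs (fps_sqrt f) i.+1 * coefs (fps_sqrt f) (n - i)%N) / 2%:R.
Proof.
rewrite [LHS]/= nth_rcons size_fps_sqrt_seq ltnn eqxx.
congr ((_ - _) / _); apply: eq_bigr => i _.
by rewrite !nth_fps_sqrt_seq // leq_subr.
Qed.

Lemma sqr_fps_sqrt (f : fps rat) :
  coefs f 0 = 1 -> fps_sqrt f ^+ 2 = f.
Proof.
move=> f0; apply: fpsP => -[|n]; rewrite expr2; first by rewrite coefsM0 mulr1.
rewrite coefsM; move: (fps_sqrtS f n) (fps_sqrt0 f); move: (fps_sqrt f) => r rS r0.
rewrite big_ord_recl big_ord_recr /= subn0 subnn r0 mul1r mulr1 rS.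
set s := \sum_(i < n) _; set t := (X in _ + (X + _) = _).
have -> : t = s by [].
by field.
Qed.

Lemma fps_sqrt_unique (f r : fps rat) :
  coefs r 0 = 1 -> r ^+ 2 = f -> r = fps_sqrt f.
Proof.
move=> r0 rf.
have f0 : coefs f 0 = 1 by rewrite -rf expr2 coefsM0 r0 mulr1.
apply/eqP; rewrite -subr_eq0; apply/eqP.
apply: (@fps_regular _ _ (r + fps_sqrt f)); first by rewrite coefsD r0 fps_sqrt0.
by rewrite -subr_sqr rf sqr_fps_sqrt // subrr.
Qed.

(* The numerator of C(a,b;x), [1 - (a-b)x - sqrt((1 - (a-b)x)^2 - 4bx)], has zero constant coefficient, so
  dividing it by [2bx] is a shift of its coefficients and a division by [2b]. *)

Definition Cnum (a b : nat) : fps rat :=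
  let x := fpsX rat in
  1 - (a%:R - b%:R) * x
  - fps_sqrt ((1 - (a%:R - b%:R) * x) ^+ 2 - 4%:R * b%:R * x).

Definition Cser (a b : nat) : fps rat :=
  Fps (fun n => coefs (Cnum a b) n.+1 / (2 * b)%:R).

Lemma Cser_closed_form (a b : nat) : (0 < b)%N ->
  2%:R * b%:R * fpsX rat * Cser a b = Cnum a b.
Proof.
move=> b0; apply: fpsP => n.
rewrite -natrM -mulrA coefs_natM coefsXM; case: n => [|n].
  rewrite mulr0 /Cnum !coefsD !coefsN coefs1 fps_sqrt0.
  by rewrite mulrC coefsXM subr0 subrr.
by rewrite [coefs _ n]/= mulrC divfK // pnatr_eq0 -lt0n muln_gt0.
Qed.

Lemma fps_natr_inj (k : nat) (f g : fps rat) : (0 < k)%N ->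
  k%:R * f = k%:R * g -> f = g.
Proof.
move=> k0 E; apply: fpsP => n.
have := congr1 (fun h => coefs h n) E; rewrite !coefs_natM.
by apply: mulfI; rewrite pnatr_eq0 -lt0n.
Qed.

Lemma Cser_eq (a b : nat) : (0 < b)%N ->
  Cser a b = 1 + (a%:R - b%:R) * fpsX rat * Cser a b
             + b%:R * fpsX rat * Cser a b ^+ 2.
Proof.
move=> b0; have := Cser_closed_form a b0; rewrite /Cnum /=.
set x := fpsX rat; set C := Cser a b; set D := 1 - _ * x.
set F := D ^+ 2 - _ => E.
have F0 : coefs F 0 = 1.
  rewrite /F /D !coefsD !coefsN !expr2 !coefsM0 !coefsD !coefsN.
  by rewrite !coefsM0 /= !mulr0 subr0 mulr1.
have : (D - 2%:R * b%:R * x * C) ^+ 2 = F.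
  by rewrite -(sqr_fps_sqrt F0) E opprB addrC subrK.
rewrite /F => E2.
apply: fpsX_inj; apply: (@fps_natr_inj (4 * b)); first by rewrite muln_gt0.
rewrite natrM -/x; apply/eqP; rewrite -subr_eq0; apply/eqP.
transitivity (D ^+ 2 - 4%:R * b%:R * x - (D - 2%:R * b%:R * x * C) ^+ 2).
  by rewrite /D; ring.
by rewrite E2 subrr.
Qed.

Lemma Cser_unique (a b : nat) (F : fps rat) : (0 < b)%N ->
  F = 1 + (a%:R - b%:R) * fpsX rat * F + b%:R * fpsX rat * F ^+ 2 ->
  F = Cser a b.
Proof.
move=> b0 EF; have EC := Cser_eq a b0.
set x := fpsX rat in EF EC; set C := Cser a b in EC *.
apply/eqP; rewrite -subr_eq0; apply/eqP.
apply: (@fps_regular _ _ (1 - x * (a%:R - b%:R + b%:R * (F + C)))).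
  by rewrite coefsD coefsN coefsXM subr0.
transitivity ((F - (1 + (a%:R - b%:R) * x * F + b%:R * x * F ^+ 2))
              - (C - (1 + (a%:R - b%:R) * x * C + b%:R * x * C ^+ 2))).
  by ring.
by rewrite -EF -EC !subrr.
Qed.

Definition riordan (R : comNzRingType) (d h : fps R) (n k : nat) : R :=
  coefs (d * h ^+ k) n.

(* A colored path is the sequence of its steps: [Up] is the step (1,1); the
  other two constructors are the step (1,-1) carrying one of the [a] colors
  available to peaks, or one of the [b] colors available elsewhere. *)

Inductive cstep (a b : nat) := Up | DownA of 'I_a | DownB of 'I_b.
Arguments Up {a b}.
Arguments DownA {a b}.
Arguments DownB {a b}.

Definition cstep_code a b (s : cstep a b) : option ('I_a + 'I_b) :=
  match s with
  | Up => None
  | DownA c => Some (inl c)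
  | DownB c => Some (inr c)
  end.
Definition cstep_decode a b (s : option ('I_a + 'I_b)) : cstep a b :=
  match s with
  | None => Up
  | Some (inl c) => DownA c
  | Some (inr c) => DownB c
  end.
Lemma cstep_codeK a b : cancel (@cstep_code a b) (@cstep_decode a b).
Proof. by case. Qed.

HB.instance Definition _ a b :=
  Finite.copy (cstep a b) (can_type (@cstep_codeK a b)).

Definition is_up a b (s : cstep a b) : bool := if s is Up then true else false.

Definition height a b (w : seq (cstep a b)) : int :=
  \sum_(s <- w) (if is_up s then 1 else -1).

Definition is_dyck a b (w : seq (cstep a b)) : bool :=
  (height w == 0) && [forall i : 'I_(size w).+1, 0 <= height (take i w)].

(* [Up] in [nth Up w] is only a default value: all indices are in range *)
Definition preceded_by_up a b (w : seq (cstep a b)) (i : nat) : bool :=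
  (0 < i)%N && is_up (nth Up w i.-1).

Definition well_colored a b (w : seq (cstep a b)) : bool :=
  [forall i : 'I_(size w),
     match nth Up w i with
     | Up => true
     | DownA _ => preceded_by_up w i
     | DownB _ => ~~ preceded_by_up w i
     end].

Definition colored_dyck (a b m : nat) : {set m.-tuple (cstep a b)} :=
  [set w : m.-tuple (cstep a b) | is_dyck w && well_colored w].

(* A step is at the level of its endpoint, hence [i.+1] *)
Definition level a b (w : seq (cstep a b)) (i : nat) : int :=
  height (take i.+1 w).

Definition up_steps_at_level a b m (w : m.-tuple (cstep a b)) (k : nat) : nat :=
  #|[set i : 'I_m | is_up (tnth w i) && (level w i == k%:Z)]|.

Definition U (a b n l : nat) : nat :=
  \sum_(w in colored_dyck a b (2 * n + 2)) up_steps_at_level w l.+1.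

(* Main.v *)
Require Import Defs.
From HB Require Import structures.
From mathcomp Require Import all_boot all_order all_algebra.
From mathcomp Require Import ring zify.
Import GRing.Theory Num.Theory.
Local Open Scope ring_scope.

(* Cut a colored Dyck path at an up step at level l+1. With t marking steps and
  K = C(a,b;t^2), the paths from height 0 to height l are counted by K (t K)^l,
  and the continuations of an up step at height l+1 down to height 0 by
  t (a-b+bK) K (b t K)^l: only the first down step can belong to a peak formed
  with the cut step. The product of the two and of t for the up step itself is
  the generating function of U, which is the Riordan array in x = t^2. The
  explicit sum comes from the expansion
  [x^m] C^k = sum_(i+j=m) k (2i+j+k-1)! / (i! j! (i+k)!) (a-b)^j b^i. *)

(** * Coefficients of the powers of C(a,b;x) *)

(* The coefficient of [(a-b)^j b^i] in [x^(i+j)] of [C^k]; for [k = i = j = 0]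
  the junk value is 0, not 1. *)
Definition ballot_coef (k i j : nat) : rat :=
  k%:R * ((2 * i + j + k).-1)`!%:R / (j`!%:R * i`!%:R * (i + k)`!%:R).

Lemma fact_neq0 (n : nat) : n`!%:R != 0 :> rat.
Proof. by rewrite pnatr_eq0 -lt0n fact_gt0. Qed.

(** With M + 1 = 2i+j+k, every term is a multiple of D = M! / (j! i! (i+k+1)!). What remains is the
    identity (k+1)(2i+j+k) = k(i+k+1) + (k+1)j + (k+2)i. A shifted term that is absent carries the
    factor j = 0 or i = 0. *)
Lemma ballot_coef_rec (k i j : nat) : (0 < i + j)%N ->
  ballot_coef k.+1 i j =
  ballot_coef k i j
  + (if j is j'.+1 then ballot_coef k.+1 i j' else 0)
  + (if i is i'.+1 then ballot_coef k.+2 i' j else 0).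
Proof.
move=> ij_gt0; have [M EM] : exists M, (2 * i + j + k)%N = M.+1.
  by exists (2 * i + j + k).-1; lia.
pose D : rat := M`!%:R / (j`!%:R * i`!%:R * (i + k.+1)`!%:R).
have Nf := fact_neq0.
have NS n : n.+1%:R != 0 :> rat by rewrite pnatr_eq0.
have -> : ballot_coef k.+1 i j = k.+1%:R * (2 * i + j + k)%:R * D.
  rewrite /ballot_coef /D addnS EM /= factS !natrM; field.
  by rewrite !Nf.
have -> : ballot_coef k i j = k%:R * (i + k.+1)%:R * D.
  rewrite /ballot_coef /D EM /= addnS factS !natrM; field.
  by rewrite !Nf -natrD nat1r NS.
have -> : (if j is j'.+1 then ballot_coef k.+1 i j' else 0) = k.+1%:R * j%:R * D.
  rewrite /D; case: j EM {ij_gt0 D} => [|j] EM; first by rewrite mulr0 mul0r.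
  rewrite /ballot_coef (_ : (2 * i + j + k.+1)%N = M.+1) /=; last by lia.
  rewrite (factS j) !natrM; field.
  by rewrite !Nf nat1r NS.
have -> : (if i is i'.+1 then ballot_coef k.+2 i' j else 0) = k.+2%:R * i%:R * D.
  rewrite /D; case: i EM {ij_gt0 D} => [|i] EM; first by rewrite mulr0 mul0r.
  rewrite /ballot_coef (_ : (2 * i + j + k.+2)%N = M.+1) /=; last by lia.
  rewrite (_ : (i + k.+2 = i.+1 + k.+1)%N); last by lia.
  have := Nf (i.+1 + k.+1)%N; move: (i.+1 + k.+1)`! => q q_neq0.
  rewrite (factS i) !natrM; field.
  by rewrite q_neq0 !Nf nat1r NS.
by rewrite -!mulrDl; congr (_ * D); rewrite mul2n -addnn !natrD -!natr1; ring.
Qed.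

Lemma coefs_Cser_pow (a b k m : nat) (hb : (0 < b)%N) : (0 < k + m)%N ->
  coefs (Cser a b ^+ k) m =
  \sum_(j < m.+1)
     ballot_coef k (m - j) j * (a%:R - b%:R) ^+ j * b%:R ^+ (m - j).
Proof.
(* [C^(n+1) = C^n + (a-b) x C^(n+1) + b x C^(n+2)] has the shape of
  [ballot_coef_rec]. *)
have Cpow n : Cser a b ^+ n.+1 = Cser a b ^+ n + fpsX rat *
    (a%:R * Cser a b ^+ n.+1 - b%:R * Cser a b ^+ n.+1 + b%:R * Cser a b ^+ n.+2).
  rewrite exprSr [X in _ * X = _]Cser_eq // !exprS; ring.
have C0 n : coefs (Cser a b ^+ n) 0 = 1.
  by elim: n => [//|n IHn]; rewrite Cpow coefsD coefsXM IHn addr0.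
(* [Cpow] expresses degree m+1 of C^(k+1) by the same degree of C^k and by degree m of C^(k+1) and
   C^(k+2): hence an outer induction on m for all exponents and an inner one on k. *)
elim: m k => [|m IHm] k; first case: k => [//|k] _.
  rewrite C0 big_ord1 subn0 !expr0 !mulr1 /ballot_coef !mul1r muln0 !add0n /=.
  by rewrite factS natrM divff // mulf_neq0 ?fact_neq0 // pnatr_eq0.
elim: k => [_|k IHk _].
  rewrite big1 // => j _; by rewrite /ballot_coef !mul0r.
rewrite Cpow coefsD coefsXM IHk ?addnS // !coefsD coefsN !coefs_natM !IHm //.
set A := a%:R - b%:R.
set B : rat := b%:R.
rewrite -mulrBl -/A !mulr_sumr.
(* Both shifted sums are extended to the range j < m+2; the added term, j = 0 in [t1] and j = m+1 in
   [t2], is zero. *)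
pose t1 j := (if j is j'.+1 then ballot_coef k.+1 (m.+1 - j) j' else 0)
  * A ^+ j * B ^+ (m.+1 - j).
pose t2 j := (if (m.+1 - j)%N is i'.+1 then ballot_coef k.+2 i' j else 0)
  * A ^+ j * B ^+ (m.+1 - j).
have -> : \sum_(i < m.+1) A * (ballot_coef k.+1 (m - i) i * A ^+ i * B ^+ (m - i))
   = \sum_(j < m.+2) t1 j.
  rewrite [RHS]big_ord_recl [X in _ = X + _]/t1 /= !mul0r add0r; apply: eq_bigr => i _.
  by rewrite /t1 /= /bump /= add1n subSS exprS; ring.
have -> : \sum_(i < m.+1) B * (ballot_coef k.+2 (m - i) i * A ^+ i * B ^+ (m - i))
   = \sum_(j < m.+2) t2 j.
  rewrite [RHS]big_ord_recr [X in _ = _ + X]/t2 /= subnn /= !mul0r addr0.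
  apply: eq_bigr => i _; by rewrite /t2 /= subSn 1?exprS -1?ltnS //; ring.
rewrite -!big_split /=; apply: eq_bigr => j _.
rewrite ballot_coef_rec; last by have := ltn_ord j; lia.
by rewrite /t1 /t2 !mulrDl addrA.
Qed.

(** * The substitution x = t^2 *)

(** This is f(t^2). It is made a ring morphism so that the quadratic equation of C carries over to
    C(t^2). *)
Definition fps_dilate {R : comNzRingType} (f : fps R) : fps R :=
  Fps (fun n => if odd n then 0 else coefs f n./2).

Lemma fps_dilate_is_zmod_morphism (R : comNzRingType) :
  zmod_morphism (@fps_dilate R).
Proof.
by move=> f g; apply: fpsP => n; rewrite coefsD coefsN /=; case: odd; rewrite ?subr0.
Qed.

(** In a product of two dilated series at an even degree, only the splittings into even degrees
    survive. *)
Lemma sum_even (V : nmodType) (F : nat -> V) (n : nat) :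
  \sum_(i < n.*2.+1) (if odd i then 0 else F i./2) = \sum_(i < n.+1) F i.
Proof.
elim: n => [|n IHn]; first by rewrite !big_ord1.
rewrite doubleS [LHS]big_ord_recr [in LHS]big_ord_recr IHn /= odd_double /=.
by rewrite addr0 [RHS]big_ord_recr /= doubleK.
Qed.

Lemma fps_dilate_is_monoid_morphism (R : comNzRingType) :
  monoid_morphism (@fps_dilate R).
Proof.
split=> [|f g]; apply: fpsP => n.
  by rewrite coefs1 /=; case: n => [|[|n]] //=; rewrite negbK if_same.
rewrite coefsM /=; case: ifPn => [odd_n|even_n].
  (* If n is odd, one of i and n - i is odd, and the corresponding factor vanishes. *)
  rewrite big1 // => i _; have := oddB (ltn_ord i : (i <= n)%N).
  by rewrite odd_n => ->; case: odd; rewrite ?mul0r ?mulr0.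
have {even_n} -> : n = n./2.*2 by rewrite even_halfK.
set m := n./2.
rewrite doubleK -(sum_even _ (fun i => coefs f i * coefs g (m - i))).
apply: eq_bigr => i _; rewrite oddB ?odd_double /=; last by rewrite -ltnS.
case: ifPn => [|even_i]; first by rewrite mul0r.
by move: (nat_of_ord i) even_i => k /even_halfK <-; rewrite -doubleB !doubleK.
Qed.

HB.instance Definition _ (R : comNzRingType) :=
  GRing.isZmodMorphism.Build (fps R) (fps R) fps_dilate
    (@fps_dilate_is_zmod_morphism R).
HB.instance Definition _ (R : comNzRingType) :=
  GRing.isMonoidMorphism.Build (fps R) (fps R) fps_dilate
    (@fps_dilate_is_monoid_morphism R).

Lemma fps_dilateX (R : comNzRingType) : fps_dilate (fpsX R) = fpsX R ^+ 2.
Proof.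
apply: fpsP => n; rewrite expr2 coefsXM /=.
by case: n => [|[|[|[|n]]]] //=; rewrite if_same.
Qed.

Lemma coefs_fps_dilate (R : comNzRingType) (f : fps R) n :
  coefs (fps_dilate f) n.*2 = coefs f n.
Proof. by rewrite /= odd_double doubleK. Qed.

(** * Sums over words of fixed length *)

(** Recursion on letters replaces sums over tuples: a word can then be cut at any position without
    casts between tuple lengths. *)
Fixpoint word_sum {V : nmodType} {T : finType} (m : nat) (F : seq T -> V) : V :=
  if m is m'.+1 then \sum_x word_sum m' (fun w => F (x :: w)) else F [::].

Lemma word_sum_tuple {V : nmodType} {T : finType} (m : nat) (F : seq T -> V) :
  \sum_(w : m.-tuple T) F w = word_sum m F.
Proof.
elim: m F => [|m IHm] F /=.
  by rewrite (big_pred1 [tuple]) // => w; apply/esym/eqP; apply: val_inj; case: w => -[].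
under [RHS]eq_bigr do rewrite -IHm.
rewrite pair_big /= (reindex (fun p : T * m.-tuple T => [tuple of p.1 :: p.2])) //=.
exists (fun w => (thead w, [tuple of behead w])) => [[x w] _|w _].
  by congr pair; apply: val_inj.
by rewrite [RHS]tuple_eta.
Qed.

Lemma eq_word_sum {V : nmodType} {T : finType} (m : nat) (F G : seq T -> V) :
  (forall w, size w = m -> F w = G w) -> word_sum m F = word_sum m G.
Proof.
elim: m F G => [|m IHm] F G eqFG /=; first exact: eqFG.
by apply: eq_bigr => x _; apply: IHm => w sz_w; apply: eqFG; rewrite /= sz_w.
Qed.

Lemma word_sum_cat {V : nmodType} {T : finType} (m1 m2 : nat) (F : seq T -> V) :
  word_sum (m1 + m2) F = word_sum m1 (fun u => word_sum m2 (fun v => F (u ++ v))).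
Proof. by elim: m1 F => //= m1 IHm F; apply: eq_bigr => x _; rewrite IHm. Qed.

Lemma word_sum_rcons {V : nmodType} {T : finType} (m : nat) (F : seq T -> V) :
  word_sum m.+1 F = word_sum m (fun u => \sum_x F (rcons u x)).
Proof.
rewrite -addn1 word_sum_cat; apply: eq_word_sum => u _ /=.
by apply: eq_bigr => x _; rewrite cats1.
Qed.

Lemma word_sum_add {V : nmodType} {T : finType} (m : nat) (F G : seq T -> V) :
  word_sum m (fun w => F w + G w) = word_sum m F + word_sum m G.
Proof.
elim: m F G => //= m IHm F G; rewrite -big_split /=.
by apply: eq_bigr => x _; rewrite IHm.
Qed.

Lemma word_sum0 {V : nmodType} {T : finType} (m : nat) (F : seq T -> V) :
  (forall w, size w = m -> F w = 0) -> word_sum m F = 0.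
Proof.
move=> F0; rewrite (eq_word_sum _ _ (fun=> 0) F0) {F0}.
by elim: m => //= m ->; rewrite big1.
Qed.

Lemma word_sum_mulr {R : pzSemiRingType} {T : finType} (m : nat)
    (F : seq T -> R) (c : R) :
  word_sum m F * c = word_sum m (fun w => F w * c).
Proof.
by elim: m F => //= m IHm F; rewrite mulr_suml; apply: eq_bigr => x _; rewrite IHm.
Qed.

Lemma word_sum_mull {R : pzSemiRingType} {T : finType} (m : nat)
    (F : seq T -> R) (c : R) :
  c * word_sum m F = word_sum m (fun w => c * F w).
Proof.
by elim: m F => //= m IHm F; rewrite mulr_sumr; apply: eq_bigr => x _; rewrite IHm.
Qed.

(** * Colored paths as runs of an automaton *)

Lemma big_cstep {V : nmodType} (a b : nat) (F : cstep a b -> V) :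
  \sum_s F s = F (@Up a b) + \sum_c F (@DownA a b c) + \sum_c F (@DownB a b c).
Proof.
rewrite (bigD1 (@Up a b)) //= -addrA; congr (_ + _).
rewrite (reindex_omap (fun s => cstep_decode (Some s)) (@cstep_code a b)) /=; last first.
  by case.
rewrite (eq_bigl predT) ?big_sumType //; first by case=> c; rewrite /= eqxx.
Qed.

(* A state is the current height together with the information whether the
  previous step was [Up]. *)
Definition cstep_move {a b : nat} (q : nat * bool) (s : cstep a b) :
    option (nat * bool) :=
  match s, q with
  | Up, (h, _) => Some (h.+1, true)
  | DownA _, (h.+1, true) => Some (h, false)
  | DownB _, (h.+1, false) => Some (h, false)
  | _, _ => None
  end.

Fixpoint run {a b : nat} (q : nat * bool) (w : seq (cstep a b)) :
    option (nat * bool) :=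
  if w is s :: w' then obind (run^~ w') (cstep_move q s) else Some q.

Lemma run_cat {a b : nat} (q : nat * bool) (u v : seq (cstep a b)) :
  run q (u ++ v) = obind (run^~ v) (run q u).
Proof. by elim: u q => //= s u IHu q; case: cstep_move => [q'|//] /=. Qed.

Lemma run_rcons {a b : nat} (q : nat * bool) (u : seq (cstep a b)) s :
  run q (rcons u s) = obind (cstep_move^~ s) (run q u).
Proof.
by rewrite -cats1 run_cat; case: run => [q'|//] /=; case: cstep_move.
Qed.

Lemma height_rcons {a b : nat} (w : seq (cstep a b)) s :
  height (rcons w s) = height w + (if is_up s then 1 else -1).
Proof. by rewrite /height -cats1 big_cat big_seq1. Qed.

Lemma nonneg_rcons {a b : nat} (w : seq (cstep a b)) s :
  [forall i : 'I_(size (rcons w s)).+1, 0 <= height (take i (rcons w s))]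
  = [forall i : 'I_(size w).+1, 0 <= height (take i w)]
    && (0 <= height (rcons w s)).
Proof.
apply/forallP/andP => [ge0|[/forallP ge0 ge0_last] i].
  split; last first.
    have lt_sz : (size (rcons w s) < (size (rcons w s)).+1)%N by [].
    by have := ge0 (Ordinal lt_sz); rewrite /= take_size.
  apply/forallP => i.
  have lt_i : (i < (size (rcons w s)).+1)%N.
    by rewrite size_rcons ltnS ltnW.
  have := ge0 (Ordinal lt_i); rewrite /= -cats1 takel_cat //.
  by rewrite -ltnS.
case: i => i /=; rewrite ltnS leq_eqVlt => /orP[/eqP ->|].
  by rewrite take_size.
rewrite size_rcons => lt_i; have := ge0 (Ordinal lt_i).
by rewrite /= -cats1 takel_cat // -ltnS.
Qed.

Lemma preceded_by_up_rcons {a b : nat} (w : seq (cstep a b)) s i :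
  (i <= size w)%N -> preceded_by_up (rcons w s) i = preceded_by_up w i.
Proof. by case: i => // i lt_i; rewrite /preceded_by_up /= nth_rcons lt_i. Qed.

Lemma preceded_by_up_last {a b : nat} (w : seq (cstep a b)) s :
  preceded_by_up (rcons w s) (size (rcons w s)) = is_up s.
Proof. by rewrite size_rcons /preceded_by_up /= nth_rcons ltnn eqxx. Qed.

Lemma well_colored_rcons {a b : nat} (w : seq (cstep a b)) s :
  well_colored (rcons w s) =
  well_colored w
  && match s with
     | Up => true
     | DownA _ => preceded_by_up w (size w)
     | DownB _ => ~~ preceded_by_up w (size w)
     end.
Proof.
apply/forallP/andP => [wc|[/forallP wc wc_last] i].
  split.
    apply/forallP => i.
    have lt_i : (i < size (rcons w s))%N by rewrite size_rcons ltnS ltnW.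
    by have := wc (Ordinal lt_i);
       rewrite /= nth_rcons ltn_ord preceded_by_up_rcons // ltnW.
  have lt_sz : (size w < size (rcons w s))%N by rewrite size_rcons.
  by have := wc (Ordinal lt_sz);
     rewrite /= nth_rcons ltnn eqxx preceded_by_up_rcons.
case: i => i /=; rewrite size_rcons ltnS leq_eqVlt => /orP[/eqP ->|lt_i].
  by rewrite nth_rcons ltnn eqxx preceded_by_up_rcons.
by have := wc (Ordinal lt_i);
   rewrite /= nth_rcons lt_i preceded_by_up_rcons // ltnW.
Qed.

(** The induction is on the last step: both conditions on a path concern its prefixes, so an
    appended step adds one height test and one color test, which are those of [cstep_move]. The
    initial flag is [false] because no step precedes the first one. *)
Lemma run_dyck {a b : nat} (w : seq (cstep a b)) :
  run (0%N, false) w =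
  if [forall i : 'I_(size w).+1, 0 <= height (take i w)] && well_colored w
  then Some (`|height w|%N, preceded_by_up w (size w)) else None.
Proof.
elim/last_ind: w => [|w s IHw].
  rewrite ifT; first by rewrite /height big_nil.
  apply/andP; split; apply/forallP => -[i lt_i] //=.
  by rewrite /height big_nil.
rewrite run_rcons IHw nonneg_rcons well_colored_rcons preceded_by_up_last {IHw}.
case: ifP => [/andP[ge0 wc]|]; last first.
  by case: [forall i, _]; case: well_colored; rewrite ?andbF.
have h_ge0 : 0 <= height w.
  have := forallP ge0 ord_max; by rewrite /= take_size.
rewrite ge0 wc height_rcons; case Eh: (height w) h_ge0 => [h|//] _.
case: s => [|c|c] /=; first by rewrite addn1.
  by case: preceded_by_up; case: h {Eh} => [|h]; rewrite ?andbF //= subn1.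
by case: preceded_by_up; case: h {Eh} => [|h]; rewrite ?andbF //= subn1.
Qed.

Lemma run_dyck_path {a b : nat} (w : seq (cstep a b)) :
  is_dyck w && well_colored w = (omap fst (run (0%N, false) w) == Some 0%N).
Proof.
rewrite run_dyck /is_dyck; case: ifP => [/andP[-> ->]|E] /=.
  by rewrite !andbT; apply/eqP/eqP => [->|[]/eqP] //; rewrite absz_eq0 => /eqP.
by rewrite -andbA E andbF.
Qed.

Lemma run_height {a b : nat} (w : seq (cstep a b)) h p :
  run (0%N, false) w = Some (h, p) -> height w = h%:Z.
Proof.
rewrite run_dyck; case: ifP => // /andP[/forallP/(_ ord_max) ge0 _] [<- _].
by move: ge0; rewrite /= take_size => /gez0_abs.
Qed.

(** * Generating functions of the two pieces of a path *)

Lemma Some_pairE (S T : eqType) (x x' : S) (y y' : T) :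
  (Some (x, y) == Some (x', y')) = (x == x') && (y == y').
Proof. by []. Qed.

(** The flag is kept apart because it decides whether a following down step has a or b colors. *)
Definition prefix_count (a b : nat) (h : nat) (p : bool) : fps rat :=
  Fps (fun m => word_sum m (fun w : seq (cstep a b) =>
    (run (0%N, false) w == Some (h, p))%:R)).

Definition suffix_count (a b : nat) (h : nat) (p : bool) : fps rat :=
  Fps (fun m => word_sum m (fun w : seq (cstep a b) =>
    (omap fst (run (h, p) w) == Some 0%N)%:R)).

Lemma prefix_count_up0 (a b : nat) : prefix_count a b 0 true = 0.
Proof.
apply: fpsP => m; rewrite coefs0 /=; apply: word_sum0 => w _.
case/lastP: w => [//|w s]; rewrite run_rcons.
case: run => [[h p]|//]; case: s => [|c|c] //; case: h p => [|h] [] //=;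
  by rewrite Some_pairE andbF.
Qed.

Lemma prefix_count_upS (a b h : nat) : prefix_count a b h.+1 true =
  fpsX rat * (prefix_count a b h true + prefix_count a b h false).
Proof.
apply: fpsP => m; rewrite coefsXM; case: m => [|m]; first by [].
rewrite coefsD [LHS]word_sum_rcons -word_sum_add; apply: eq_word_sum => w _.
rewrite big_cstep !big1 ?addr0 => [|c _|c _]; rewrite run_rcons.
- case: run => [[h' p]|//] /=; rewrite -natrD.
  rewrite !Some_pairE eqSS eqxx andbT.
  by case: p; case: eqP.
- by case: run => [[[|h'] []]|] //=; rewrite Some_pairE andbF.
- by case: run => [[[|h'] []]|] //=; rewrite Some_pairE andbF.
Qed.

(** The last step is removed: it descends from height h+1 with a colors after an up step and b
    colors otherwise. The empty path gives the term for h = 0. *)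
Lemma prefix_count_down (a b h : nat) : prefix_count a b h false =
  (h == 0%N)%:R + fpsX rat *
    (a%:R * prefix_count a b h.+1 true + b%:R * prefix_count a b h.+1 false).
Proof.
apply: fpsP => m; rewrite coefsD coefsXM; case: m => [|m].
  by rewrite addr0; case: h.
rewrite (_ : coefs (h == 0%N)%:R _ = 0); last by case: h.
rewrite [LHS]word_sum_rcons add0r coefsD !coefs_natM.
rewrite [coefs (prefix_count _ _ _ true) m]/=.
rewrite [coefs (prefix_count _ _ _ false) m]/=.
rewrite !word_sum_mull -word_sum_add; apply: eq_word_sum => w _.
rewrite big_cstep run_rcons [X in X + _ + _](_ : _ = 0); last first.
  by case: run => [[h' p]|] //=; rewrite Some_pairE andbF.
rewrite add0r; congr (_ + _).
- under eq_bigr do rewrite run_rcons.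
  by case: run => [[[|h'] []]|] /=; rewrite sumr_const card_ord mulr_natl;
     rewrite ?Some_pairE ?eqSS ?andbF.
- under eq_bigr do rewrite run_rcons.
  by case: run => [[[|h'] []]|] /=; rewrite sumr_const card_ord mulr_natl;
     rewrite ?Some_pairE ?eqSS ?andbF.
Qed.

(** Here the first step is removed; the flag p only affects the number of colors of a first down
    step. *)
Lemma suffix_count_rec (a b h : nat) p : suffix_count a b h p =
  (h == 0%N)%:R + fpsX rat *
   (suffix_count a b h.+1 true
    + (if h is h'.+1 then (if p then a else b)%:R * suffix_count a b h' false else 0)).
Proof.
apply: fpsP => m; rewrite coefsD coefsXM; case: m => [|m].
  by rewrite addr0; case: h.
rewrite (_ : coefs (h == 0%N)%:R _ = 0); last by case: h.
rewrite add0r coefsD [LHS]big_cstep -addrA; congr (_ + _).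
case: h => [|h]; first by rewrite coefs0 !big1 ?addr0 // => c _; apply: word_sum0.
rewrite coefs_natM; case: p => /=.
  rewrite sumr_const card_ord mulr_natl big1 ?addr0 // => c _.
  exact: word_sum0.
rewrite [X in X + _ = _]big1 => [|c _]; last exact: word_sum0.
by rewrite add0r sumr_const card_ord mulr_natl.
Qed.

(* Words are counted by number of steps, so [C] enters as [C(t^2)]. *)
Definition Cdil (a b : nat) : fps rat := fps_dilate (Cser a b).

Lemma Cdil_eq (a b : nat) : (0 < b)%N ->
  Cdil a b - 1 =
  fpsX rat ^+ 2 * Cdil a b * (a%:R - b%:R + b%:R * Cdil a b).
Proof.
move=> hb; have := congr1 fps_dilate (Cser_eq a hb).
rewrite !rmorphD !rmorphM !rmorphB !rmorph_nat /= fps_dilateX rmorph1.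
rewrite -/(Cdil a b) => E.
by rewrite [X in X - 1]E; ring.
Qed.

(** Cutting at the last up step to each level 1, ..., h gives (tK)^h for paths that end with an up
    step, h > 0. Otherwise a nonempty Dyck path follows, whence the factor K - 1; for h = 0 the
    empty path is added. The proof checks that these series satisfy the recurrences above. *)
Lemma prefix_countE (a b h : nat) : (0 < b)%N ->
  prefix_count a b h true + prefix_count a b h false =
  Cdil a b * (fpsX rat * Cdil a b) ^+ h.
Proof.
move=> hb; move: h.
have [PT PF] : (forall h, prefix_count a b h true =
    (if h is _.+1 then (fpsX rat * Cdil a b) ^+ h else 0)) /\
  (forall h, prefix_count a b h false =
    (h == 0%N)%:R + (Cdil a b - 1) * (fpsX rat * Cdil a b) ^+ h).
  (* The recurrences change h but carry a factor t, so the induction is on the degree m, for both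
     flags and all h at once. *)
  suff E m : (forall h, coefs (prefix_count a b h true) m =
    coefs (if h is _.+1 then (fpsX rat * Cdil a b) ^+ h else 0) m) /\
  (forall h, coefs (prefix_count a b h false) m =
    coefs ((h == 0%N)%:R + (Cdil a b - 1) * (fpsX rat * Cdil a b) ^+ h) m).
    by split=> h; apply: fpsP => m; have [] := E m.
  set X := fpsX rat; set K := Cdil a b.
  have eqT h : (X * K) ^+ h.+1 = X * ((if h is _.+1 then (X * K) ^+ h else 0)
       + ((h == 0%N)%:R + (K - 1) * (X * K) ^+ h)).
    by case: h => [|h]; rewrite ?expr0 !exprS /=; ring.
  have eqF h : (K - 1) * (X * K) ^+ h =
      X * (a%:R * (X * K) ^+ h.+1
           + b%:R * ((h.+1 == 0%N)%:R + (K - 1) * (X * K) ^+ h.+1)).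
    transitivity (X ^+ 2 * K * (a%:R - b%:R + b%:R * K) * (X * K) ^+ h).
      by congr (_ * _); apply: Cdil_eq.
    by rewrite !exprS /=; ring.
  elim: m => [|m [IHT IHF]]; split=> h.
  - case: h => [|h]; first by rewrite prefix_count_up0.
    by rewrite prefix_count_upS eqT !coefsXM.
  - by rewrite prefix_count_down eqF !coefsD !coefsXM.
  - case: h => [|h]; first by rewrite prefix_count_up0.
    rewrite prefix_count_upS eqT !coefsXM !coefsD IHT IHF coefsD.
    by congr (_ + _).
  - rewrite prefix_count_down eqF coefsD [in RHS]coefsD !coefsXM.
    by rewrite !coefsD !coefs_natM IHT IHF !coefsD.
by move=> h; rewrite PT PF; case: h => [|h]; rewrite ?expr0 /=; ring.
Qed.

(** After an up step to height h+1, the first descent to height h is either immediate, with a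
    colors, or follows a nonempty Dyck path and has b colors: t(a + b(K-1)). Then comes a Dyck path,
    and each of the h remaining levels gives a non-peak descent and a Dyck path, btK. The formal
    proof is again by recurrence on the degree. *)
Lemma suffix_countE (a b h : nat) : (0 < b)%N ->
  suffix_count a b h.+1 true =
  fpsX rat * (a%:R - b%:R + b%:R * Cdil a b) * Cdil a b
    * (b%:R * fpsX rat * Cdil a b) ^+ h.
Proof.
move=> hb; move: h.
set X := fpsX rat; set K := Cdil a b; set Y := b%:R * X * K.
pose Z := a%:R - b%:R + b%:R * K.
have eqK : K - 1 = X ^+ 2 * K * Z by exact: Cdil_eq.
suff E m : (forall h, coefs (suffix_count a b h.+1 true) m =
    coefs (X * Z * K * Y ^+ h) m) /\
  (forall h, coefs (suffix_count a b h false) m = coefs (K * Y ^+ h) m).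
  by move=> h; apply: fpsP => m; have [] := E m.
have eqT h : X * Z * K * Y ^+ h = X * (X * Z * K * Y ^+ h.+1 + a%:R * (K * Y ^+ h)).
  have -> : X * Z * K * Y ^+ h = X * (b%:R * (K - 1) + a%:R) * K * Y ^+ h.
    by rewrite /Z; ring.
  by rewrite eqK [Y ^+ h.+1]exprS; move: (Y ^+ h) => y; rewrite /Y; ring.
have eqF0 : K = 1 + X * (X * Z * K).
  by rewrite -[LHS](subrK 1) eqK; ring.
have eqF h : K * Y ^+ h.+1 = X * (X * Z * K * Y ^+ h.+1 + b%:R * (K * Y ^+ h)).
  rewrite [Y ^+ h.+1]exprS; move: (Y ^+ h) => y; rewrite [RHS]mulrDr.
  (* Only the leading K is expanded: its 1 gives the term of the down step, the rest that of the up
     step. *)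
  rewrite {1}eqF0 /Y; ring.
elim: m => [|m [IHT IHF]]; split=> h.
- by rewrite suffix_count_rec coefsD eqT !coefsXM addr0.
- rewrite suffix_count_rec coefsD; case: h => [|h].
    by rewrite mulr1 eqF0 coefsD !coefsXM.
  by rewrite eqF !coefsXM addr0.
- rewrite suffix_count_rec coefsD eqT !coefsXM add0r !coefsD !coefs_natM.
  by rewrite IHT IHF.
- rewrite suffix_count_rec coefsD coefsXM coefsD IHT; case: h => [|h].
    rewrite coefs0 addr0 expr0 !mulr1 -[in RHS]/K.
    by rewrite [X in _ = coefs X _]eqF0 coefsD coefsXM.
  by rewrite eqF coefsXM coefsD !coefs_natM IHF add0r.
Qed.

(** * Cutting a path at an up step *)

(** Write w = u s v with u of length i. The step s must be [Up], and its level forces u to end at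
    height l; either flag of u is allowed, hence the sum. After s the state is (l+1, [true]),
    whatever the flag of u. *)
Lemma sum_up_split (a b l i k : nat) :
  word_sum (i + k.+1) (fun w : seq (cstep a b) =>
    (is_dyck w && well_colored w
     && (is_up (nth (@Up a b) w i) && (level w i == l.+1%:Z)))%:R) =
  (coefs (prefix_count a b l true) i + coefs (prefix_count a b l false) i)
  * coefs (suffix_count a b l.+1 true) k.
Proof.
rewrite word_sum_cat -word_sum_add word_sum_mulr; apply: eq_word_sum => u size_u.
rewrite [LHS]big_cstep /= !big1 ?addr0 => [|c _|c _]; last 2 first.
- by apply: word_sum0 => v _; rewrite nth_cat size_u ltnn subnn /= andbF.
- by apply: word_sum0 => v _; rewrite nth_cat size_u ltnn subnn /= andbF.
rewrite word_sum_mull; apply: eq_word_sum => v _.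
rewrite run_dyck_path nth_cat size_u ltnn subnn run_cat.
rewrite /level -cat_rcons take_size_cat ?size_rcons ?size_u //= height_rcons.
case Eu: (run _ u) => [[h p]|] /=; last by rewrite mul0r.
rewrite (run_height _ _ _ Eu) !Some_pairE -natrD.
rewrite (_ : (h%:Z + 1 == l.+1%:Z) = (h == l)); last by lia.
case: (h =P l) => [->|_]; last by rewrite andbF mul0r.
by case: p {Eu}; rewrite mul1r andbT.
Qed.

(** Summing over positions before paths turns U into a convolution of prefixes and suffixes. The
    degree is 2n+1 because the cut step itself is in neither piece. *)
Lemma U_prefix_suffix (a b n l : nat) :
  (U a b n l)%:R =
  coefs ((prefix_count a b l true + prefix_count a b l false)
         * suffix_count a b l.+1 true) (2 * n + 1).
Proof.
pose F i (w : seq (cstep a b)) : rat := (is_dyck w && well_colored w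
  && (is_up (nth (@Up a b) w i) && (level w i == l.+1%:Z)))%:R.
transitivity
  (\sum_(i < 2 * n + 2) \sum_(w : (2 * n + 2).-tuple (cstep a b)) F i w).
  rewrite exchange_big /= /U natr_sum big_mkcond /=; apply: eq_bigr => w _.
  rewrite inE /F; case: (_ && _); last by rewrite big1.
  rewrite /up_steps_at_level -sum1_card natr_sum big_mkcond /=.
  apply: eq_bigr => i _; rewrite inE (tnth_nth (@Up a b)).
  by case: (_ && _).
rewrite coefsM (_ : (2 * n + 1).+1 = 2 * n + 2)%N; last by rewrite addn2 addn1.
apply: eq_bigr => i _.
rewrite (word_sum_tuple _ (F i)) coefsD -sum_up_split.
by congr word_sum; have := ltn_ord i; lia.
Qed.

(** * The Riordan array and the explicit sum *)

Lemma coefs_bxpowM (b l n : nat) (f : fps rat) :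
  coefs ((b%:R * fpsX rat) ^+ l * f) n =
  if (l <= n)%N then b%:R ^+ l * coefs f (n - l) else 0.
Proof.
elim: l n => [|l IHl] n; first by rewrite expr0 !mul1r subn0.
rewrite exprS -!mulrA coefs_natM coefsXM.
by case: n => [|n]; rewrite ?mulr0 // IHl ltnS exprS subSS -mulrA
  (fun_if ( *%R b%:R)) mulr0.
Qed.

(** With N = 2m-j+k, the factorials of [ballot_coef] are (N-1)! = N!/N and (i+k)! = (N-m)! for i =
    m-j; the m! of the first binomial cancels against that of the second. *)
Lemma ballot_coef_bin (k m j : nat) : (j <= m)%N -> (0 < k)%N ->
  ballot_coef k (m - j) j =
  'C(m, j)%:R * (k%:R / (2 * m - j + k)%:R * 'C(2 * m - j + k, m)%:R).
Proof.
move=> le_jm k_gt0; rewrite /ballot_coef.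
have -> : (2 * (m - j) + j + k = 2 * m - j + k)%N by lia.
have E : (2 * m - j + k = (2 * m - j + k).-1.+1)%N by lia.
have binE p q : (q <= p)%N -> 'C(p, q)%:R = p`!%:R / (q`!%:R * (p - q)`!%:R) :> rat.
  move=> le_qp; rewrite -(bin_fact le_qp) !natrM; field.
  by rewrite !fact_neq0.
rewrite !binE; [|lia|lia].
have -> : (2 * m - j + k - m = m - j + k)%N by lia.
rewrite {2 3}E factS natrM; field.
by rewrite !fact_neq0 nat1r pnatr_eq0.
Qed.

Theorem theorem7p2 (a b : nat) (ha : (0 < a)%N) (hb : (0 < b)%N) :
  (forall n l : nat, (l <= n)%N ->
     (U a b n l)%:R =
     \sum_(0 <= j < (n - l).+1)
        'C(n - l, j)%:R
        * ((2 * (l + 1))%:R * (a%:R - b%:R) / (2 * n - j + 2)%:R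
             * 'C(2 * n - j + 2, n - l)%:R
           + (2 * l + 3)%:R * b%:R / (2 * n - j + 3)%:R
             * 'C(2 * n - j + 3, n - l)%:R)
        * (a%:R - b%:R) ^+ j * b%:R ^+ (n - j) :> rat)
  /\ U a b 0 0 = a
  /\ (forall n l : nat,
        (U a b n l)%:R =
        riordan (Cser a b ^+ 2 * (a%:R - b%:R + b%:R * Cser a b))
                (b%:R * fpsX rat * Cser a b ^+ 2) n l).
Proof.
(* The Riordan form comes first; the sum and the value at (0,0) are read off from it. *)
have URiordan n l : (U a b n l)%:R =
    riordan (Cser a b ^+ 2 * (a%:R - b%:R + b%:R * Cser a b))
            (b%:R * fpsX rat * Cser a b ^+ 2) n l.
  rewrite U_prefix_suffix /riordan -(coefs_fps_dilate _ _ n) suffix_countE //.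
  rewrite prefix_countE //.
  have -> : fps_dilate (Cser a b ^+ 2 * (a%:R - b%:R + b%:R * Cser a b)
      * (b%:R * fpsX rat * Cser a b ^+ 2) ^+ l) =
    Cdil a b ^+ 2 * (a%:R - b%:R + b%:R * Cdil a b)
      * (b%:R * fpsX rat ^+ 2 * Cdil a b ^+ 2) ^+ l.
    have dil_nat k : fps_dilate (k%:R : fps rat) = k%:R by apply: rmorph_nat.
    have dilM : {morph @fps_dilate rat : f g / f * g} by apply: rmorphM.
    have dilX k : {morph @fps_dilate rat : f / f ^+ k} by apply: rmorphXn.
    have dilD : {morph @fps_dilate rat : f g / f + g} by apply: rmorphD.
    have dilN : {morph @fps_dilate rat : f / - f} by apply: rmorphN.
    by rewrite dilM dilX dilM dilX dilM dilM dilX 2!dilD dilN dilM !dil_nat fps_dilateX.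
  rewrite addn1 mul2n.
  set lhs := (X in coefs X _ = _); set rhs := (X in _ = coefs X _).
  (* The factor t of the suffix series accounts for the shift from degree 2n+1 to 2n. *)
  suff -> : lhs = fpsX rat * rhs by rewrite coefsXM.
  by rewrite /lhs /rhs !exprMn; ring.
split; last split=> //.
- move=> n l le_ln; rewrite URiordan /riordan.
  (* The factor a-b+bC splits the series into the powers C^(2l+2) and C^(2l+3), which yield the two
     terms in braces. *)
  have -> : Cser a b ^+ 2 * (a%:R - b%:R + b%:R * Cser a b)
      * (b%:R * fpsX rat * Cser a b ^+ 2) ^+ l =
    (b%:R * fpsX rat) ^+ l * (a%:R * Cser a b ^+ (2 * (l + 1))
     - b%:R * Cser a b ^+ (2 * (l + 1)) + b%:R * Cser a b ^+ (2 * l + 3)).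
    rewrite exprMn -exprM mulnDr !(exprD _ (2 * l)%N).
    by move: (_ ^+ (2 * l)) (_ ^+ l) => p q; ring.
  rewrite coefs_bxpowM le_ln !coefsD coefsN !coefs_natM !coefs_Cser_pow //; try lia.
  rewrite -mulrBl !mulr_sumr -big_split /= mulr_sumr big_mkord.
  apply: eq_bigr => j _; have le_j : (j <= n - l)%N by rewrite -ltnS.
  rewrite !ballot_coef_bin //; try lia.
  have -> : (2 * (n - l) - j + 2 * (l + 1) = 2 * n - j + 2)%N by lia.
  have -> : (2 * (n - l) - j + (2 * l + 3) = 2 * n - j + 3)%N by lia.
  (* The power of b collects b^l from (bx)^l and b^(n-l-j) from the expansion of the power of C. *)
  have -> : (n - j = l + (n - l - j))%N by lia.
  by rewrite exprD; ring.
- apply/eqP; rewrite -(eqr_nat rat) URiordan /riordan mulr1 expr2 !coefsM0 coefsD.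
  have C0 : coefs (Cser a b) 0 = 1.
    have -> : Cser a b = 1 + fpsX rat *
        ((a%:R - b%:R) * Cser a b + b%:R * Cser a b ^+ 2).
      by rewrite {1}Cser_eq //; ring.
    by rewrite coefsD coefsXM addr0.
  have nat0 k (f : fps rat) : coefs (k%:R * f) 0 = k%:R * coefs f 0.
    exact: coefs_natM.
  (* The constants a and b are written as products with 1 so that [nat0] applies; the value is a - b
     + b. *)
  rewrite C0 nat0 C0 coefsD coefsN -[a%:R]mulr1 -[X in - coefs X _]mulr1 !nat0.
  by rewrite coefs1 !mulr1 !mul1r subrK.
Qed.
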